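(* Let $\mathcal{C}$ be a class of clause-sets with $\mathcal{VMU} \cap \mathcal{SED} \subseteq \mathcal{C} \subseteq \mathcal{LEAN}$, and let $k \in \mathbb{N}$. Then $\mathrm{minvdeg}(\mathcal{C}_{\delta = k}) = \mathrm{N}(k)$, where $\mathcal{C}_{\delta=k} = \{F \in \mathcal{C} : \delta(F) = k\}$.
   Context: Literals come with a fixed-point-free involution $x \mapsto \overline{x}$; variables are the positive literals. A clause is a finite set $C$ of literals with $C \cap \overline{C} = \emptyset$; a clause-set is a finite set of clauses. For a clause-set $F$: $\mathrm{var}(F)$ its variables, $n(F) = |\mathrm{var}(F)|$, $c(F) = |F|$, $\delta(F) = c(F) - n(F)$; $\mathrm{ld}_F(x)$ is the number of clauses containing literal $x$, $\mathrm{vdeg}_F(v) = \mathrm{ld}_F(v) + \mathrm{ld}_F(\overline{v})$, $\mathrm{minvdeg}(F) = \min_{v \in \mathrm{var}(F)} \mathrm{vdeg}_F(v)$ for $n(F)>0$. For a class $\mathcal{D}$ of clause-sets, $\mathrm{minvdeg}(\mathcal{D}) \in \mathbb{N}_0 \cup \{+\infty\}$ is the supremum of $\mathrm{minvdeg}(F)$ over $F \in \mathcal{D}$ with $n(F) > 0$, and $0$ if there is no such $F$. The surplus $\sigma(F)$ is $\min_{\emptyset \ne V \subseteq \mathrm{var}(F)} (|\{C \in F : \mathrm{var}(C) \cap V \ne \emptyset\}| - |V|)$ for $n(F) > 0$ and $0$ otherwise. A partial assignment is a map $\varphi : V \to \{0,1\}$ on a finite set $V$ of variables ($\varphi(\overline{v})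 = 1-\varphi(v)$); $F$ is satisfiable iff some partial assignment satisfies (makes true some literal of) every clause. An autarky for $F$ is a partial assignment $\varphi$ such that every clause of $F$ containing a literal falsified by $\varphi$ contains a literal satisfied by $\varphi$. $\mathcal{LEAN}$ is the class of clause-sets $F$ having no autarky $\varphi$ with $\mathrm{var}(\varphi) \cap \mathrm{var}(F) \ne \emptyset$. $\mathcal{VMU}$ (variable-minimally unsatisfiable) is the class of unsatisfiable $F$ such that every unsatisfiable $F' \subseteq F$ has $\mathrm{var}(F') = \mathrm{var}(F)$. $\mathcal{SED}$ is the class of clause-sets $F$ with $\sigma(F) = \delta(F)$. $\mathrm{N} : \mathbb{N} \to \mathbb{N}$ is defined by $\mathrm{N}(1) = 2$ and $\mathrm{N}(k) = \max_{i \in \{2,\dots,k\}} \min(2i, \mathrm{N}(k-i+1)+i)$ for $k \ge 2$. *)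

(* Defs.v *)
From HB Require Import structures.
From mathcomp Require Import all_boot all_order all_algebra.
From mathcomp Require Import finmap.
Set Implicit Arguments. Unset Strict Implicit. Unset Printing Implicit Defensive.
Import Order.TTheory GRing.Theory Num.Theory.
Local Open Scope fset_scope.
Local Open Scope fmap_scope.

(* Variables are natural numbers; a literal is a pair (v, b): b = true is the
   positive literal v, b = false is its complement.  The involution
   x |-> compl x flips the sign and is fixed-point free. *)
Definition lit := (nat * bool)%type.
Definition compl (x : lit) : lit := (x.1, ~~ x.2).
Definition litvar (x : lit) : nat := x.1.

Definition clause := {fset lit}.
Definition clauseset := {fset clause}.

Definition is_clause (C : clause) : Prop := forall x, x \in C -> compl x \notin C.
Definition is_cls (F : clauseset) : Prop := forall C, C \in F -> is_clause C.

Definition varC (C : clause) : {fset nat} := [fset litvar x | x in C].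
Definition varF (F : clauseset) : {fset nat} := \bigcup_(C <- F) varC C.

Definition nF (F : clauseset) : nat := #|` varF F|.
Definition cF (F : clauseset) : nat := #|` F|.
Definition deltaF (F : clauseset) : int := (cF F)%:Z - (nF F)%:Z.

Definition ld (F : clauseset) (x : lit) : nat := #|` [fset C in F | x \in C]|.
Definition vdeg (F : clauseset) (v : nat) : nat := ld F (v, true) + ld F (v, false).
(* minimum of vdeg over var(F); the neutral element (sum of all degrees) is an
   upper bound of every term, hence irrelevant whenever n(F) > 0 (the only case
   in which minvdeg is used). *)
Definition sumvdeg (F : clauseset) : nat := (\sum_(v <- varF F) vdeg F v)%N.
Definition minvdeg (F : clauseset) : nat :=
  (\big[minn/sumvdeg F]_(v <- varF F) vdeg F v)%N.

Definition surplus_val (F : clauseset) (V : {fset nat}) : int :=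
  (#|` [fset C in F | varC C `&` V != fset0]|)%:Z - (#|` V|)%:Z.
(* minimum over nonempty V subset of var(F); the neutral element is the value at
   V = var(F), which belongs to the range whenever n(F) > 0. *)
Definition surplus (F : clauseset) : int :=
  if nF F == 0%N then 0%R
  else \big[Num.min/surplus_val F (varF F)]_(V <- fpowerset (varF F) | V != fset0)
         surplus_val F V.

Definition passign := {fmap nat -> bool}.
Definition sat_lit (phi : passign) (x : lit) : bool := phi.[? x.1] == Some x.2.
Definition fals_lit (phi : passign) (x : lit) : bool := phi.[? x.1] == Some (~~ x.2).

Definition satisfiable (F : clauseset) : Prop :=
  exists phi : passign, forall C, C \in F -> exists2 x, x \in C & sat_lit phi x.

Definition autarky (phi : passign) (F : clauseset) : Prop :=
  forall C, C \in F -> (exists2 x, x \in C & fals_lit phi x) ->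
                       (exists2 x, x \in C & sat_lit phi x).

Definition LEAN (F : clauseset) : Prop :=
  is_cls F /\ forall phi : passign, autarky phi F -> domf phi `&` varF F = fset0.

Definition VMU (F : clauseset) : Prop :=
  is_cls F /\ ~ satisfiable F /\
  forall F' : clauseset, F' `<=` F -> ~ satisfiable F' -> varF F' = varF F.

Definition SED (F : clauseset) : Prop := is_cls F /\ surplus F = deltaF F.

(* Supremum in N_0 \cup {+oo} of a set of naturals is the finite value m
   (least upper bound; the empty set has supremum 0). *)
Definition nat_sup_is (S : nat -> Prop) (m : nat) : Prop :=
  (forall x, S x -> x <= m) /\ (forall b, (forall x, S x -> x <= b) -> m <= b).

Definition minvdeg_class_is (D : clauseset -> Prop) (m : nat) : Prop :=
  nat_sup_is (fun x => exists F, [/\ D F, (0 < nF F)%N & minvdeg F = x]) m.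

(* The function N : N -> N; N(1) = 2, N(k) = max_{2<=i<=k} min(2i, N(k-i+1)+i).
   Computed with fuel (fuel k suffices since arguments strictly decrease). *)
Fixpoint Nfuel (fuel k : nat) : nat :=
  match fuel with
  | 0 => 0
  | f.+1 => if k <= 1 then 2
            else \max_(2 <= i < k.+1) minn (2 * i) (Nfuel f (k - i + 1) + i)
  end.
Definition Nfun (k : nat) : nat := Nfuel k k.

(* Main.v *)
(** Upper bound: by induction on [|U|], a lean clause-set over [U] with at most
    [|U| + k] clauses has a variable of degree at most [N(k)]. If some proper
    nonempty [V] is touched by at most [|V| + k] clauses, restrict to [V].
    Otherwise satisfy a literal of [v], choosing the sign that occurs at least
    as often, say [a] times. An autarky on [W] of the remaining clauses would
    touch more than [|W| + k] of the original ones, so the clauses left after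
    applying it would be too few for a lean kernel; hence the remaining clauses
    are lean, with deficiency bound [k - a + 1], and
    [min (2a, N(k-a+1) + a)] bounds the degree of [v] or of a variable found
    inductively.

    Lower bound: take [m] with [2^m <= k + m] and [k + m + 2 <= 2^(m+1)], and
    over [m + 1] variables the unit clause [v], all [2^m] full clauses containing
    the complement of [v], and any [k + m - 2^m] full clauses containing [v].
    Every variable has degree at least [k + m >= N(k)]. *)
From Stdlib Require Import Classical.
Require Import Defs.
From mathcomp Require Import all_boot all_order all_algebra.
From mathcomp Require Import finmap.
From mathcomp Require Import zify.
Set Implicit Arguments. Unset Strict Implicit. Unset Printing Implicit Defensive.
Import Order.TTheory GRing.Theory Num.Theory.
Local Open Scope fset_scope.
Local Open Scope nat_scope.

(** * The recursion for [N] and bounds on its values *)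

Lemma Nfuel_eq f g k : 0 < k -> k <= f -> k <= g -> Nfuel f k = Nfuel g k.
Proof.
elim: f g k => [|f IH] [|g] k k0 kf kg //=; try lia.
case: leqP => // k1.
rewrite !big_nat; apply: eq_bigr => i /andP[i2 ik].
by congr (minn _ (_ + _)); apply: IH; lia.
Qed.

Lemma NfunE k : 1 < k ->
  Nfun k = \max_(2 <= i < k.+1) minn (2 * i) (Nfun (k - i + 1) + i).
Proof.
move=> k1; rewrite /Nfun; case: k k1 => // k k1 /=.
rewrite leqNgt k1 /= !big_nat; apply: eq_bigr => i /andP[i2 ik].
by congr (minn _ (_ + _)); apply: Nfuel_eq; lia.
Qed.

Lemma Nfun_geq k i : 1 < i -> i <= k ->
  minn (2 * i) (Nfun (k - i + 1) + i) <= Nfun k.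
Proof.
move=> i2 ik; rewrite [leqRHS]NfunE; last by lia.
pose G j := minn (2 * j) (Nfun (k - j + 1) + j).
apply: (@leq_bigmax_seq _ (index_iota 2 k.+1) xpredT G i) => //.
by rewrite mem_index_iota; lia.
Qed.

Lemma Nfun_leq k x : 1 < k ->
  (forall i, 1 < i -> i <= k -> minn (2 * i) (Nfun (k - i + 1) + i) <= x) ->
  Nfun k <= x.
Proof.
move=> k1 H; rewrite NfunE //; apply/bigmax_leqP_seq => i.
by rewrite mem_index_iota => /andP[i1 ik] _; exact: H.
Qed.

(** For [1 < k], the term [i = k] of the maximum is [min(2k, k + 2)]. *)
Lemma Nfun_gt k : 0 < k -> k < Nfun k.
Proof.
case: (ltnP 1 k) => k1 k0; last by rewrite (_ : k = 1) //; lia.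
apply: leq_trans (Nfun_geq k1 (leqnn k)).
by rewrite subnn add0n (_ : Nfun 1 = 2) //; lia.
Qed.

(** Each term of the maximum is at most [k + m]: either [2 * i] already is, or [i] exceeds half of
    [k + m]. In the latter case the left side of the hypothesis is halved on passing to [k - i + 1]
    and [m - 1], and induction applies. *)
Lemma Nfun_le_log k m : 0 < k -> k + m + 2 <= 2 ^ m.+1 -> Nfun k <= k + m.
Proof.
elim/ltn_ind: k m => k IH [|m] k0 km; first by move: km; rewrite expn1; lia.
case: (ltnP 1 k) => k1; last first.
  by have -> : k = 1 by lia.
apply: Nfun_leq => // i i2 ik.
case: (leqP (2 * i) (k + m.+1)) => h; first by lia.
have := IH (k - i + 1) ltac:(lia) m ltac:(lia).
rewrite expnS in km; move=> /(_ ltac:(lia)); lia.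
Qed.

(** * Cardinalities of filtered sets as counts *)

Lemma card_sepE (T : choiceType) (F : {fset T}) (p : pred T) :
  #|` [fset x in F | p x]| = count p F.
Proof.
rewrite -size_filter; apply: perm_size; apply: uniq_perm.
- exact: fset_uniq.
- by rewrite filter_uniq // fset_uniq.
by move=> x; rewrite mem_filter !inE andbC.
Qed.

Lemma count_sepE (T : choiceType) (F : {fset T}) (p q : pred T) :
  count p [fset x in F | q x] = count (predI p q) F.
Proof.
rewrite -card_sepE -card_sepE; congr (size (enum_fset _)).
by apply/fsetP => x; rewrite !inE /= andbAC andbA.
Qed.

(** * Autarkies and leanness relative to a set of variables *)

Definition touches (V : {fset nat}) (C : clause) := varC C `&` V != fset0.

Lemma touchesP V C :
  reflect (exists2 x, x \in C & litvar x \in V) (touches V C).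
Proof.
apply: (iffP (fset0Pn _)) => [[i]|[x xC xV]].
  by rewrite inE => /andP[/imfsetP[x /= xC ->] iV]; exists x.
by exists (litvar x); rewrite inE xV in_imfset.
Qed.

(* A clause is read here as its restriction to the variables of [V] (below, of
   [U]): literals over other variables are ignored rather than deleted. *)
Definition sat_on (phi : nat -> bool) (V : {fset nat}) (F : clauseset) :=
  forall C, C \in F -> touches V C ->
    exists2 x, x \in C & (litvar x \in V) && (phi (litvar x) == x.2).

(** [sat_on phi V F] makes [phi] on [V] an autarky: every touched clause is satisfied. Values of
    [phi] outside [V] are irrelevant, so total functions replace partial maps. *)
Definition lean_on (F : clauseset) (U : {fset nat}) :=
  forall V phi, V `<=` U -> sat_on phi V F -> V = fset0.

(** Autarkies compose: while one on a nonempty [V] exists, discard the clauses it touches and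
    continue on the remaining variables. *)
Lemma lean_kernel (F : clauseset) U : exists W phi, [/\ W `<=` U, sat_on phi W F &
  lean_on [fset C in F | ~~ touches W C] (U `\` W)].
Proof.
have [n] := ubnP #|` U|; elim: n => // n IH in F U *; move=> Un.
have [FU|] := classic (lean_on F U).
  exists fset0, xpredT; split; first exact: fsub0set.
    by move=> C _ /touchesP[x]; rewrite inE.
  rewrite fsetD0 => V phi VU H; apply: (FU V phi) => // C CF.
  apply: H; rewrite !inE CF /=; apply/touchesP => -[x]; by rewrite inE.
move=> /not_all_ex_not[V] /not_all_ex_not[phi] H.
have {H}[VU [satV V0]] : V `<=` U /\ sat_on phi V F /\ V <> fset0 by tauto.
have cU : #|` U `\` V| < #|` U|.
  have : 0 < #|` V| by rewrite cardfs_gt0; exact/eqP.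
  by have := fsubset_leq_card VU; rewrite cardfsDS //; lia.
have [|W [psi [WU satW lW]]] := IH [fset C in F | ~~ touches V C] (U `\` V).
  by lia.
(* The two assignments do not conflict, since [W] avoids [V]. *)
exists (V `|` W), (fun i => if i \in V then phi i else psi i); split.
- by rewrite fsubUset VU (fsubset_trans WU) // fsubsetDl.
- move=> C CF tC; have [tV|tV] := boolP (touches V C).
    have [x xC /andP[xV xp]] := satV C CF tV.
    by exists x => //; rewrite inE xV.
  have tW : touches W C.
    have /touchesP[x xC] := tC; rewrite inE => /orP[xV|xW].
      by case/negP: tV; apply/touchesP; exists x.
    by apply/touchesP; exists x.
  have [|x xC /andP[xW xp]] := satW C _ tW; first by rewrite !inE CF.
  exists x => //; rewrite inE xW orbT /=.
  by have := fsubsetP WU _ xW; rewrite inE => /andP[/negbTE->].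
rewrite fsetDDl in lW.
have -> : [fset C in F | ~~ touches (V `|` W) C] =
  [fset C in [fset C in F | ~~ touches V C] | ~~ touches W C].
  apply/fsetP => C; rewrite !inE /=; case: (C \in _) => //=.
  by rewrite /touches fsetIUr fsetU_eq0 !negbK.
exact: lW.
Qed.

(** * Literal occurrences and variable degrees *)

Lemma vdegE (F : clauseset) v :
  vdeg F v = count (fun C : clause => (v, true) \in C) F +
             count (fun C : clause => (v, false) \in C) F.
Proof. by rewrite /vdeg /ld !card_sepE. Qed.

Lemma touches_lit V (C : clause) v b : (v, b) \in C -> v \in V -> touches V C.
Proof. by move=> vC vV; apply/touchesP; exists (v, b). Qed.

Lemma vdeg_touches (F : clauseset) (V : {fset nat}) v : v \in V ->
  vdeg [fset C in F | touches V C] v = vdeg F v.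
Proof.
move=> vV; rewrite !vdegE !count_sepE.
by congr (_ + _); apply: eq_count => C /=;
  apply: andb_idr => vC; exact: touches_lit vC vV.
Qed.

Lemma is_cls_sub (F G : clauseset) : G `<=` F -> is_cls F -> is_cls G.
Proof. by move=> /fsubsetP GF H C /GF; exact: H. Qed.

Lemma vdegE_negb (F : clauseset) v b :
  vdeg F v = count (fun C : clause => (v, b) \in C) F +
             count (fun C : clause => (v, ~~ b) \in C) F.
Proof. by rewrite vdegE; case: b => //=; rewrite addnC. Qed.

Lemma is_cls_disjoint (F : clauseset) v b (C : clause) : is_cls F -> C \in F ->
  ~~ (((v, b) \in C) && ((v, ~~ b) \in C)).
Proof.
move=> clF CF; apply/negP => /andP[vC vnC].
by have := clF _ CF _ vC; rewrite /compl /= vnC.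
Qed.

(** No clause contains both literals of [v], so none is counted twice. *)
Lemma vdeg_card (F : clauseset) v : is_cls F ->
  vdeg F v = count (fun C : clause => touches [fset v] C) F.
Proof.
move=> clF; rewrite vdegE -count_predUI [X in _ + X](eq_in_count (a2 := pred0)); last first.
  move=> C CF; exact/negbTE/(@is_cls_disjoint F v true).
rewrite count_pred0 addn0; apply: eq_count => C /=.
apply/orP/touchesP => [[vC|vC]|[[w b] wC]].
- by exists (v, true); rewrite ?inE.
- by exists (v, false); rewrite ?inE.
by rewrite inE => /eqP /= <-; case: b wC; [left|right].
Qed.

(** If a literal of [v] never occurred, setting it to false would be an autarky on [v] alone. *)
Lemma lean_on_lit (F : clauseset) U v b : lean_on F U -> v \in U ->
  0 < count (fun C : clause => (v, b) \in C) F.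
Proof.
move=> FU vU; rewrite lt0n; apply/negP => /eqP c0.
have /fsetP/(_ v) : [fset v] = fset0; last by rewrite !inE eqxx.
apply: (FU _ (fun=> ~~ b)); first by rewrite fsub1set.
move=> C CF /touchesP[[w d] xC]; rewrite inE => /eqP /= wv; subst w.
exists (v, d) => //; rewrite inE eqxx /=.
have [db|] := eqVneq d b; last by case: d b {FU c0 xC} => -[].
suff : 0 < count (fun C : clause => (v, b) \in C) F by rewrite c0.
by rewrite -has_count; apply/hasP; exists C; rewrite -?db.
Qed.

(** Each discarded clause contributes at most one to the degree of [w]. *)
Lemma vdeg_drop (F : clauseset) v b w : is_cls F ->
  vdeg F w <= vdeg [fset C in F | (v, b) \notin C] w +
              count (fun C : clause => (v, b) \in C) F.
Proof.
move=> clF; rewrite !vdeg_card //; last first.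
  by apply: is_cls_sub clF; apply/fsubsetP => C; rewrite !inE => /andP[].
rewrite count_sepE -count_predUI; apply: leq_trans (leq_addr _ _).
apply: sub_count => C /= ->; exact: orNb.
Qed.

(** * Upper bound on the minimum degree of lean clause-sets *)

Lemma lean_on_degree (F : clauseset) U k :
  is_cls F -> U != fset0 -> lean_on F U -> #|` F| <= #|` U| + k ->
  0 < k /\ exists2 v, v \in U & vdeg F v <= Nfun k.
Proof.
have [n] := ubnP #|` U|; elim: n => // n IH in F U k * => Un clF U0 FU cFU.
have clsub (p : pred clause) : is_cls [fset C in F | p C].
  by apply: is_cls_sub clF; apply/fsubsetP => C; rewrite !inE => /andP[].
have [[V [VU V0 cV]]|noV] := classic (exists V, [/\ V `<` U, V != fset0 &
    #|` [fset C in F | touches V C]| <= #|` V| + k]).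
  have [|V' phi V'V satV'|//|k0 [v vV dv]] :=
    IH [fset C in F | touches V C] V k _ (clsub _) V0.
  - by have := fproper_ltn_card VU; lia.
  - apply: (FU V' phi); first exact: fsubset_trans V'V (fproper_sub VU).
    move=> C CF tC; apply: satV' => //; rewrite !inE CF /=.
    have /touchesP[x xC xV] := tC; apply/touchesP; exists x => //.
    exact: (fsubsetP V'V).
  split=> //; exists v; first exact: (fsubsetP (fproper_sub VU)).
  by rewrite -(vdeg_touches F vV).
have [v vU] := fset0Pn _ U0.
(* The majority sign makes the degree of [v] at most [2 * a]. *)
have [b hb] : exists b, count (fun C : clause => (v, ~~ b) \in C) F <=
                        count (fun C : clause => (v, b) \in C) F.
  have /orP[h|h] := leq_total (count (fun C : clause => (v, ~~ true) \in C) F)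
    (count (fun C : clause => (v, true) \in C) F); by [exists true|exists false].
have a0 := lean_on_lit b FU vU.
have a0' := lean_on_lit (~~ b) FU vU.
have dv := vdegE_negb F v b.
set a := count (fun C : clause => (v, b) \in C) F in hb a0 dv.
set a' := count (fun C : clause => (v, ~~ b) \in C) F in hb a0' dv.
pose F' := [fset C in F | (v, b) \notin C].
have cF' : #|` F'| + a = #|` F|.
  by rewrite card_sepE addnC; exact: count_predC.
have cU' : #|` U `\ v|.+1 = #|` U| by rewrite [in RHS](cardfsD1 v) vU.
have [W [phi [WU satW lW]]] := lean_kernel F' (U `\ v).
have vW : v \notin W by apply/negP => /(fsubsetP WU); rewrite !inE eqxx.
have WpU : W `<` U.
  rewrite fproperE (fsubset_trans WU) ?fsubsetDl //=.
  by apply/fsubsetPn; exists v.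
have [W0|W0] := eqVneq W fset0; last first.
  set F2 := [fset C in F' | ~~ touches W C] in lW.
  have cF2 : #|` F2| + #|` [fset C in F | touches W C]| <= #|` F|.
    rewrite !card_sepE count_sepE -(count_predC (touches W) F) addnC leq_add2l.
    by apply: sub_count => C /= /andP[].
  have cU2 : #|` (U `\ v) `\` W| + #|` W| = #|` U `\ v|.
    by rewrite cardfsDS // subnK // fsubset_leq_card.
  have cW : #|` W| + k < #|` [fset C in F | touches W C]|.
    rewrite ltnNge; apply/negP => cW; apply: noV; by exists W.
  (* By [cF2], [cU2] and [cW], at most as many clauses as variables remain. If variables remain,
     induction with parameter [0] yields [0 < 0]. *)
  have [U2|U2] := eqVneq ((U `\ v) `\` W) fset0; last first.
    have [|||//] := IH F2 ((U `\ v) `\` W) 0 _ _ U2 lW; [lia| |lia].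
    by apply: is_cls_sub (clsub (fun C => (v, b) \notin C)); apply/fsubsetP => C;
      rewrite !inE => /andP[].
  have F20 : F2 = fset0.
    by apply/eqP; rewrite -cardfs_eq0; move: cU2; rewrite U2 cardfs0; lia.
  have : U = fset0; last by move/eqP: U0.
  (* With no clause left, extending [phi] by the literal [(v, b)] gives an autarky on all of [U]: a
     clause without that literal must touch [W]. *)
  apply: (FU U (fun i => if i == v then b else phi i)) => // C CF tC.
  have [vC|vC] := boolP ((v, b) \in C); first by exists (v, b); rewrite //= vU !eqxx.
  have CF' : C \in F' by rewrite !inE CF.
  have [tW|tW] := boolP (touches W C); last first.
    by have := in_fset0 C; rewrite -F20 !inE CF vC tW.
  have [x xC /andP[xW xp]] := satW C CF' tW; exists x => //.
  rewrite (fsubsetP (fproper_sub WpU)) //=.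
  case: (litvar x =P v) => [xv|_]; last exact: xp.
  by move: vW; rewrite -xv xW.
have {}lW : lean_on F' (U `\ v).
  subst W; rewrite fsetD0 in lW => V psi VU satV; apply: (lW V psi) => // C.
  by rewrite !inE => /andP[CF' _]; apply: satV; rewrite !inE.
(* If [v] is the only variable, its degree is at most [k + 1]; as both literals occur, it is also at
   least 2, so [0 < k]. *)
have [U1|U1] := eqVneq (U `\ v) fset0.
  have dvF : vdeg F v <= #|` F| by rewrite vdeg_card // count_size.
  have cU1 : #|` U| = 1 by rewrite -cU' U1 cardfs0.
  have k0 : 0 < k by have := leq_trans dvF cFU; rewrite dv cU1; lia.
  split=> //; exists v => //; have := Nfun_gt k0; lia.
(* The subtraction is truncated, which only weakens the clause bound; the positivity [k0] then gives
   [a <= k]. *)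
have [||k0 [w wU dw]] := IH F' (U `\ v) (k + 1 - a) _ (clsub _) U1 lW;
  [lia|lia|].
have ak : a <= k by lia.
split; first by lia.
(* The value [a = 1] is outside the range of the recursion, but then [v] has degree 2. *)
have [a1|a1] := leqP a 1.
  exists v => //; have := @Nfun_gt k; lia.
have Nk := Nfun_geq a1 ak.
have dwF := vdeg_drop v b w clF.
rewrite -/a -/F' in dwF; rewrite (_ : k + 1 - a = k - a + 1) in dw; last by lia.
have [le|le] := leqP (2 * a) (Nfun (k - a + 1) + a).
  by exists v => //; lia.
exists w; first by move: wU; rewrite !inE => /andP[].
lia.
Qed.

(** * Passage to [LEAN] and [minvdeg] *)

Lemma LEAN_lean_on (F : clauseset) : LEAN F -> lean_on F (varF F).
Proof.
move=> [_ lF] V phi VF satV.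
pose psi : passign := [fmap x : V => phi (val x)]%fmap.
have psiE i : i \in V -> (psi.[? i])%fmap = Some (phi i).
  by move=> iV; rewrite in_fnd ffunE.
have : autarky psi F.
  move=> C CF [x xC fx].
  have xV : litvar x \in V.
    move: fx; rewrite /fals_lit; case: fndP => //.
  have [|y yC /andP[yV /eqP yp]] := satV C CF; first by apply/touchesP; exists x.
  by exists y => //; rewrite /sat_lit psiE // yp.
by move=> /lF /=; move/fsetIidPl: VF ->.
Qed.

Lemma bigminn_leq (T : eqType) (f : T -> nat) x0 (s : seq T) v :
  v \in s -> \big[minn/x0]_(w <- s) f w <= f v.
Proof.
elim: s => // w s IH; rewrite inE big_cons geq_min => /orP[/eqP<-|/IH->].
  by rewrite leqnn.
by rewrite orbT.
Qed.

Lemma leq_minvdeg (F : clauseset) d : 0 < nF F ->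
  (forall v, v \in varF F -> d <= vdeg F v) -> d <= minvdeg F.
Proof.
rewrite cardfs_gt0 => /fset0Pn[v vF] H; rewrite /minvdeg big_seq.
apply: (big_ind (fun x => d <= x)) => [|x y dx dy|//].
(* The neutral element of the minimum is a sum with [vdeg F v] among its terms, hence also at least
   [d]. *)
- rewrite /sumvdeg (big_fsetD1 v vF) /=; exact: leq_trans (H _ vF) (leq_addr _ _).
- by rewrite leq_min dx.
Qed.

Lemma mem_varF (F : clauseset) (C : clause) i : C \in F -> i \in varC C -> i \in varF F.
Proof. by move=> CF iC; apply/bigfcupP; exists C; rewrite ?CF. Qed.

(** * The extremal clause-sets: unsatisfiability, surplus and degrees *)

Section Extremal.

Variables (D : {fset nat}) (m : nat) (T : {fset {fset nat}}).
Hypotheses (mD : m \notin D) (D0 : D != fset0) (TD : T `<=` fpowerset D).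

(** [P] is the sign pattern: the variables of [D] that occur positively. *)
Definition full_clause (b : bool) (P : {fset nat}) : clause :=
  (m, b) |` [fset (i, i \in P) | i in D].

(** The size of [T] tunes the deficiency, which is [2 ^ #|D| + #|T| - #|D|]. *)
Definition extremal : clauseset :=
  [fset (m, true)] |` ([fset full_clause false P | P in fpowerset D] `|`
                       [fset full_clause true P | P in T]).

Lemma in_full_clause b P i c : ((i, c) \in full_clause b P) =
  (i == m) && (c == b) || (i \in D) && (c == (i \in P)).
Proof.
rewrite !inE /= xpair_eqE; congr (_ || _).
apply/imfsetP/andP => /= [[j jD [-> ->]] //|[iD /eqP->]]; by exists i.
Qed.

Lemma varC_full_clause b P : varC (full_clause b P) = m |` D.
Proof.
apply/fsetP => i; rewrite !inE; apply/imfsetP/orP => /=.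
  move=> [[j c]]; rewrite in_full_clause => /orP[]/andP[h _] ->; first by left.
  by right.
move=> [/eqP->|iD]; first by exists (m, b); rewrite // in_full_clause !eqxx.
by exists (i, i \in P); rewrite // in_full_clause iD eqxx orbT.
Qed.

Lemma in_extremal C : reflect [\/ C = [fset (m, true)],
    exists2 P, P `<=` D & C = full_clause false P |
    exists2 P, P \in T & C = full_clause true P] (C \in extremal).
Proof.
rewrite !inE; apply: (iffP or3P) => -[].
- by move/eqP=> ->; apply: Or31.
- by case/imfsetP=> P /=; rewrite fpowersetE => PD ->; apply: Or32; exists P.
- by case/imfsetP=> P /= PT ->; apply: Or33; exists P.
- by move=> ->; apply: Or31.
- by case=> P PD ->; apply: Or32; apply: in_imfset; rewrite /= fpowersetE.
- by case=> P PT ->; apply: Or33; apply: in_imfset.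
Qed.

Lemma varC_unit : varC [fset (m, true)] = [fset m].
Proof.
apply/fsetP => i; rewrite inE; apply/imfsetP/eqP => [[x /=]|->].
  by rewrite inE => /eqP-> ->.
by exists (m, true); rewrite /= ?inE.
Qed.

Lemma varC_extremal C : C \in extremal -> C != [fset (m, true)] -> varC C = m |` D.
Proof. by case/in_extremal => [->|[P _ ->]|[P _ ->]]; rewrite ?eqxx ?varC_full_clause. Qed.

Lemma varF_extremal : varF extremal = m |` D.
Proof.
apply/eqP; rewrite eqEfsubset; apply/andP; split; last first.
  apply/fsubsetP => i iD; apply: (@mem_varF _ (full_clause false fset0)).
    by apply/in_extremal/Or32; exists fset0; rewrite ?fsub0set.
  by rewrite varC_full_clause.
apply/bigfcupsP => C CF _.
have [->|Cu] := eqVneq C [fset (m, true)]; last by rewrite varC_extremal.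
by rewrite varC_unit fsub1set !inE eqxx.
Qed.

Lemma full_clause_inj b : {in fpowerset D &, injective (full_clause b)}.
Proof.
move=> P Q; rewrite !fpowersetE => PD QD /fsetP PQ; apply/fsetP => i.
have [iD|iD] := boolP (i \in D); last first.
  by apply/idP/idP => [/(fsubsetP PD)|/(fsubsetP QD)]; rewrite (negbTE iD).
have im : i != m by apply: contraNneq mD => <-.
have := PQ (i, i \in P); rewrite !in_full_clause (negbTE im) iD /= eqxx.
by move/esym/eqP.
Qed.

Lemma full_clause_neq P Q : full_clause false P != full_clause true Q.
Proof.
apply/eqP => /fsetP/(_ (m, false)).
by rewrite !in_full_clause eqxx (negbTE mD).
Qed.

Lemma unit_neq_full b P : [fset (m, true)] != full_clause b P.
Proof.
have [i iD] := fset0Pn _ D0.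
apply/eqP => /(congr1 varC); rewrite varC_unit varC_full_clause => /fsetP/(_ i).
by rewrite !inE iD orbT => /eqP im; move: mD; rewrite -im iD.
Qed.

Lemma card_extremal : #|` extremal| = (2 ^ #|` D| + #|` T|).+1.
Proof.
rewrite cardfsU1 inE negb_or.
rewrite (_ : _ \notin _); last first.
  by apply/imfsetP => -[P _] /eqP; exact/negP/unit_neq_full.
rewrite (_ : _ \notin _); last first.
  by apply/imfsetP => -[P _] /eqP; exact/negP/unit_neq_full.
rewrite add1n; congr _.+1.
rewrite cardfsU (_ : _ `&` _ = fset0) ?cardfs0 ?subn0.
  rewrite card_in_imfset /= ?card_fpowerset; last exact: full_clause_inj.
  rewrite card_in_imfset //= => P Q PT QT.
  by apply: full_clause_inj; exact: (fsubsetP TD).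
apply/fsetP => C; rewrite !inE; apply/negP => /andP[/imfsetP[P _ ->]].
by move=> /imfsetP[Q _] /eqP; exact/negP/full_clause_neq.
Qed.

Lemma is_cls_extremal : is_cls extremal.
Proof.
move=> C /in_extremal[->|[P _ ->]|[P _ ->]] [i c]; rewrite /compl /=.
- by rewrite !inE !xpair_eqE => /andP[-> /eqP->].
all: rewrite !in_full_clause; have [->|] := eqVneq i m; rewrite ?(negbTE mD) /= ?orbF.
all: by [case: c | move=> _ /andP[-> /eqP->]; case: (i \in P)].
Qed.

(* Only the unit clause can miss a variable. *)
Lemma count_touches_extremal (V : {fset nat}) : V != fset0 -> V `<=` m |` D ->
  #|` extremal|.-1 + (m \in V) <= count (touches V) extremal.
Proof.
move=> V0 VD.
have tF C : C \in extremal -> C != [fset (m, true)] -> touches V C.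
  move=> CF Cu; rewrite /touches (varC_extremal CF Cu).
  by rewrite (fsetIidPr VD).
have uF : [fset (m, true)] \in extremal by rewrite !inE eqxx.
have [mV|mV] := boolP (m \in V).
  rewrite addn1 prednK; last by rewrite card_extremal.
  rewrite (_ : count _ _ = #|` extremal|) //; apply/eqP; rewrite -all_count.
  apply/allP => C CF; have [->|] := eqVneq C [fset (m, true)]; last exact: tF.
  by apply: (@touches_lit _ _ m true); rewrite ?inE.
rewrite addn0 -(count_predC (pred1 [fset (m, true)]) extremal).
rewrite count_uniq_mem ?fset_uniq // uF /=.
rewrite (eq_in_count (a2 := predI (predC (pred1 [fset (m, true)])) (touches V))).
  by apply: sub_count => C /andP[].
move=> C CF /=; apply/esym/andb_idr => /tF; exact.
Qed.

Lemma unsat_extremal : ~ satisfiable extremal.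
Proof.
move=> [phi H].
have [|x] := H [fset (m, true)]; first by rewrite !inE eqxx.
rewrite inE => /eqP-> /eqP /= pm.
(* The full clause with this pattern disagrees with [phi] wherever [phi] is defined on [D];
   undefined variables satisfy no literal. *)
pose P := [fset i in D | (phi.[? i])%fmap == Some false].
have [|[i c]] := H (full_clause false P).
  apply/in_extremal/Or32; exists P => //.
  by apply/fsubsetP => i; rewrite !inE => /andP[].
rewrite in_full_clause => /orP[/andP[/eqP-> /eqP->]|/andP[iD /eqP->]].
  by rewrite /sat_lit /= pm.
by rewrite /sat_lit /= !inE iD /=; case: (phi.[? i])%fmap => [[]|].
Qed.

(* The all-true assignment satisfies every clause except the all-negative one,
   which mentions every variable. *)
Lemma VMU_extremal : VMU extremal.
Proof.
split; first exact: is_cls_extremal.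
split; first exact: unsat_extremal.
move=> F' sF' uF'; apply/eqP; rewrite eqEfsubset; apply/andP; split.
  apply/bigfcupsP => C CF' _; apply/fsubsetP => i.
  by apply: mem_varF; exact: (fsubsetP sF').
rewrite varF_extremal.
suff CF' : full_clause false fset0 \in F'.
  by apply/fsubsetP => i iD; apply: (mem_varF CF'); rewrite varC_full_clause.
apply/negPn/negP => CF'; apply: uF'.
exists [fmap i : m |` D => true]%fmap => C CF.
have satT i : i \in m |` D -> sat_lit [fmap i : m |` D => true]%fmap (i, true).
  by move=> iD; rewrite /sat_lit /= in_fnd ffunE.
have [->|[P PD eC]|[P _ ->]] := in_extremal _ (fsubsetP sF' _ CF).
- by exists (m, true); rewrite ?inE // satT // !inE eqxx.
- have /fset0Pn[i iP] : P != fset0.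
    by apply: contraNneq CF' => P0; rewrite -P0 -eC.
  have iD := fsubsetP PD _ iP.
  exists (i, true); first by rewrite eC in_full_clause iD iP orbT.
  by apply: satT; rewrite !inE iD orbT.
- exists (m, true); first by rewrite in_full_clause !eqxx.
  by apply: satT; rewrite !inE eqxx.
Qed.

Lemma nF_extremal : nF extremal = #|` D|.+1.
Proof. by rewrite /nF varF_extremal cardfsU1 mD. Qed.

Lemma minvdeg_extremal : #|` extremal|.-1 <= minvdeg extremal.
Proof.
apply: leq_minvdeg => [|v]; first by rewrite nF_extremal.
rewrite varF_extremal => vD; rewrite (vdeg_card _ is_cls_extremal).
apply: leq_trans (leq_addr _ _) (count_touches_extremal _ _).
  by rewrite -cardfs_gt0 cardfs1.
by rewrite fsub1set.
Qed.

(** The value at the full variable set is the deficiency, and no other [V] goes below it: if [V]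
    contains [m], all clauses are touched; otherwise at most the unit clause is missed, and [V] also
    lacks the variable [m]. *)
Lemma SED_extremal : SED extremal.
Proof.
split; first exact: is_cls_extremal.
have delta (V : {fset nat}) : V != fset0 -> V `<=` m |` D ->
    (deltaF extremal <= surplus_val extremal V)%R.
  move=> V0 VD; rewrite /deltaF /surplus_val nF_extremal /cF card_sepE.
  have := count_touches_extremal V0 VD; rewrite /touches card_extremal /=.
  move: (count _ _) (2 ^ _) => c e.
  have := fsubset_leq_card VD; rewrite cardfsU1 mD.
  have [mV|mV] := boolP (m \in V) => /=; first by lia.
  have VD' : V `<=` D.
    apply/fsubsetP => i iV; have := fsubsetP VD _ iV; rewrite !inE.
    by case/orP => // /eqP im; move: mV; rewrite -im iV.
  have := fsubset_leq_card VD'; move: (#|` V|) (#|` D|) => v d; lia.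
rewrite /surplus nF_extremal /= varF_extremal.
have full0 : m |` D != fset0 by apply/fset0Pn; exists m; rewrite !inE eqxx.
have deltaE : surplus_val extremal (m |` D) = deltaF extremal.
  apply/eqP; rewrite eq_le delta // andbT.
  rewrite /surplus_val /deltaF /nF varF_extremal /cF lerD2r lez_nat card_sepE.
  exact: count_size.
rewrite deltaE; apply/eqP; rewrite eq_le bigmin_le_id /=.
rewrite big_seq_cond; apply: le_bigmin => // V /andP[].
by rewrite fpowersetE => VD V0; exact: delta.
Qed.

End Extremal.

(** * Realising every deficiency, and the supremum over the class *)

Lemma VMU_SED_large_minvdeg k : 0 < k -> exists F,
  [/\ VMU F, SED F, deltaF F = k%:Z, (0 < nF F)%N & (Nfun k <= minvdeg F)%N]%R.
Proof.
move=> k0.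
have ex : exists m, k + m + 2 <= 2 ^ m.+1.
  exists k; elim: k k0 => // -[//|k] IH _.
  by have := IH isT; rewrite [in 2 ^ k.+3]expnS; lia.
(* The least exponent is taken, here named [m.+1]; failure of the inequality at its predecessor is
   exactly [mk]. *)
case: (ex_minnP ex) => -[|m] km mmin; first by move: km; rewrite expn1; lia.
have {mmin} mk : 2 ^ m.+1 <= k + m.+1.
  rewrite leqNgt; apply/negP => h; have := mmin m; lia.
pose D : {fset nat} := [fset i in iota 0 m.+1].
have cD : #|` D| = m.+1 by rewrite card_fseq undup_id ?iota_uniq // size_iota.
have mD : m.+1 \notin D by rewrite in_fset mem_iota add0n ltnn andbF.
have D0 : D != fset0 by rewrite -cardfs_gt0 cD.
(* Any patterns of this number give deficiency [k]: [mk] makes the subtraction exact, and [km]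
   ensures that enough subsets of [D] exist. *)
pose T : {fset {fset nat}} :=
  [fset P in take (k + m.+1 - 2 ^ m.+1) (enum_fset (fpowerset D))].
have TD : T `<=` fpowerset D by apply/fsubsetP => P; rewrite inE => /mem_take.
have cT : #|` T| = k + m.+1 - 2 ^ m.+1.
  rewrite card_fseq undup_id ?take_uniq ?fset_uniq // size_takel //.
  by rewrite card_fpowerset cD; move: km; rewrite [in 2 ^ m.+2]expnS; lia.
have cE : #|` extremal D m.+1 T| = k + m.+2.
  by rewrite card_extremal // cD cT; lia.
exists (extremal D m.+1 T); split.
- exact: VMU_extremal.
- exact: SED_extremal.
- by rewrite /deltaF /cF cE nF_extremal // cD; lia.
- by rewrite nF_extremal.
apply: leq_trans (minvdeg_extremal mD D0 TD); rewrite cE addnS /=.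
exact: Nfun_le_log.
Qed.

Theorem theorem9p14 (Cl : clauseset -> Prop)
  (hlow : forall F, VMU F -> SED F -> Cl F)
  (hup : forall F, Cl F -> LEAN F)
  (k : nat) (hk : (1 <= k)%N) :
  minvdeg_class_is (fun F => Cl F /\ deltaF F = Posz k) (Nfun k).
Proof.
split=> [x [F [[CF dF] nF0 <-]]|b Hb].
  have lF := hup F CF.
  have F0 : varF F != fset0 by rewrite -cardfs_gt0.
  have cF : #|` F| <= #|` varF F| + k by move: dF; rewrite /deltaF /cF /nF; lia.
  have [_ [v vF dv]] := lean_on_degree lF.1 F0 (LEAN_lean_on lF) cF.
  exact: leq_trans (bigminn_leq _ _ vF) dv.
have [F [vmu sed dF nF0 le]] := VMU_SED_large_minvdeg hk.
by apply: leq_trans le (Hb _ _); exists F; split=> //; split=> //; exact: hlow.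
Qed.
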